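(* There exist $2^{\mathfrak{c}}$ maximal $\mathsf{d}$-independent families $\{\mathcal{A}_\alpha:\alpha<2^{\mathfrak{c}}\}$ such that $|\mathcal{A}_\alpha|=\mathfrak{c}$ for each $\alpha<2^{\mathfrak{c}}$ and the sets $\mathsf{d}[\langle\mathcal{A}_\alpha\rangle]$, $\alpha<2^{\mathfrak{c}}$, are pairwise distinct (that is, $\mathsf{d}[\langle\mathcal{A}_\alpha\rangle]\neq\mathsf{d}[\langle\mathcal{A}_\beta\rangle]$ whenever $\alpha\neq\beta$).
   Context: Let $\omega=\{0,1,2,\ldots\}$ and identify $n\in\omega$ with $\{0,\ldots,n-1\}$. $\mathcal{D}$ is the family of all $A\subseteq\omega$ for which the asymptotic density $\mathsf{d}(A):=\lim_{n\to\infty}|A\cap n|/n$ exists. For $\mathcal{A}\subseteq\mathcal{P}(\omega)$, $\langle\mathcal{A}\rangle$ denotes the field of subsets of $\omega$ generated by $\mathcal{A}$. For $\mathcal{F}\subseteq\mathcal{D}$, $\mathsf{d}[\mathcal{F}]:=\{\mathsf{d}(A):A\in\mathcal{F}\}$. A nonempty family $\mathcal{A}\subseteq\mathcal{D}$ is $\mathsf{d}$-independent if: (1) $\mathsf{d}(A)\in(0,1)$ for all $A\in\mathcal{A}$; (2) $\langle\mathcal{A}\rangle\subseteq\mathcal{D}$; (3) $\mathsf{d}(\bigcap\mathcal{F})=\prod_{A\in\mathcal{F}}\mathsf{d}(A)$ for every nonempty finite $\mathcal{F}\subseteq\mathcal{A}$. It is a maximal $\mathsf{d}$-independent family if it is $\mathsf{d}$-independent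 and not properly contained in another $\mathsf{d}$-independent family. $\mathfrak{c}=2^{\aleph_0}$. *)

(* Defs.v *)
From mathcomp Require Import all_boot all_order all_algebra finmap.
From mathcomp Require Import all_classical all_reals all_analysis.
Import Order.TTheory GRing.Theory Num.Theory.
Import numFieldNormedType.Exports.

Set Implicit Arguments.
Unset Strict Implicit.
Unset Printing Implicit Defensive.

Local Open Scope classical_set_scope.
Local Open Scope ring_scope.

(* The term at n = 0 is 0 / 0 = 0, which does not affect the limit. *)
Definition density_seq (R : realType) (A : set nat) : R^nat :=
  fun n => #|` fset_set (A `&` `I_n)|%:R / n%:R.

Definition has_density (R : realType) : set (set nat) :=
  [set A | cvgn (density_seq R A)].

(* Meaningful only on [has_density R]. *)
Definition density (R : realType) (A : set nat) : R := limn (density_seq R A).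

Definition field_of_sets (T : Type) (G : set (set T)) : Prop :=
  [/\ G setT, setU_closed G & setC_closed G].

Definition generated_field (T : Type) (F : set (set T)) : set (set T) :=
  smallest (@field_of_sets T) F.

Definition d_independent (R : realType) (A : set (set nat)) : Prop :=
  [/\ A !=set0 /\ A `<=` has_density R,
      forall B, A B -> 0 < density R B < 1,
      generated_field A `<=` has_density R &
      forall F : set (set nat), F !=set0 -> finite_set F -> F `<=` A ->
        density R (\bigcap_(B in F) B) = \prod_(B <- fset_set F) density R B].

Definition maximal_d_independent (R : realType) (A : set (set nat)) : Prop :=
  d_independent R A /\
  ~ exists B, d_independent R B /\ A `<` B.

(* Main.v *)
(* Start from continuum many sets of density 1/2, d-independent as an indexed
   family and arranged in rows of countably many. From a row one can build a set E
   of any density t in [0, 1], independent of everything that the row is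
   independent of. To each set B of naturals attach its own row. If B, of density
   b, is independent of the current family, then collapsing its row to the single
   set B `&` E keeps the family d-independent, and it can no longer be extended by
   B; moreover t is free, so b * t can be made a power of 1/2. Hence, by Zorn, a
   set of collapsed rows that is maximal for d-independence yields a maximal
   d-independent family, and all its densities are powers of 1/2.

   To code alpha, further rows indexed by x in alpha are collapsed to sets of
   density t_x, where the t_x are Liouville-like numbers such that no t_x is in the
   ring generated by 1/2 and the other t_y. The densities of members of the
   generated field lie in the ring generated by the densities of the family, so
   that t_x occurs among them exactly when x is in alpha. *)
Require Import Defs.
From mathcomp Require Import all_boot all_order all_algebra.
From mathcomp Require Import all_classical all_reals all_analysis.
From mathcomp Require Import finmap zify ring lra.
Import Order.TTheory GRing.Theory Num.Theory.
Import numFieldNormedType.Exports.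

Set Implicit Arguments.
Unset Strict Implicit.
Unset Printing Implicit Defensive.

Local Open Scope classical_set_scope.
Local Open Scope ring_scope.

(** * Cesàro means, with asymptotic density as the case of indicators *)

Section CesaroMean.
Variable R : realType.
Implicit Types (f g : nat -> R) (a b : R).

Definition has_mean f a := (fun n => (\sum_(k < n) f k) / n%:R) @ \oo --> a.

Lemma has_mean_unique f a b : has_mean f a -> has_mean f b -> a = b.
Proof. by move=> /(cvg_lim (@Rhausdorff R)) <- /(cvg_lim (@Rhausdorff R)) <-. Qed.

Lemma eq_has_mean f g a : f =1 g -> has_mean f a -> has_mean g a.
Proof. by move=> /funext ->. Qed.

Lemma has_meanD f g a b :
  has_mean f a -> has_mean g b -> has_mean (fun n => f n + g n) (a + b).
Proof.
move=> fa gb; rewrite /has_mean.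
under eq_fun do rewrite big_split /= mulrDl.
exact: cvgD.
Qed.

Lemma has_meanZ f a c : has_mean f a -> has_mean (fun n => c * f n) (c * a).
Proof.
move=> fa; rewrite /has_mean.
under eq_fun do rewrite -mulr_sumr -mulrA.
exact: cvgMl_tmp.
Qed.

Lemma has_meanB f g a b :
  has_mean f a -> has_mean g b -> has_mean (fun n => f n - g n) (a - b).
Proof.
move=> fa /(has_meanZ (c := -1)) gb; apply: eq_has_mean.
  by move=> n; rewrite -[in RHS](mulN1r (g n)).
by rewrite -(mulN1r b); apply: has_meanD.
Qed.

Lemma has_mean0 : has_mean (fun=> 0) 0.
Proof.
rewrite /has_mean; under eq_fun do rewrite big1 ?mul0r//.
exact: cvg_cst.
Qed.

Lemma has_mean1 : has_mean (fun=> 1) 1.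
Proof.
rewrite /has_mean; under eq_fun do rewrite sumr_const card_ord.
apply: cvg_near_cst; near=> n.
by rewrite divff// pnatr_eq0 -lt0n; near: n; exact: nbhs_infty_gt.
Unshelve. all: by end_near. Qed.

Lemma has_mean_squeeze f a :
  (forall e, 0 < e -> exists f1 f2 a1 a2,
    [/\ forall n, f1 n <= f n <= f2 n, has_mean f1 a1, has_mean f2 a2,
        a - e <= a1 & a2 <= a + e]) -> has_mean f a.
Proof.
move=> H; apply/cvgrPdist_le => e e0.
have e20 : 0 < e / 2 by rewrite divr_gt0.
have [f1 [f2 [a1 [a2 [ff m1 m2 h1 h2]]]]] := H _ e20.
move/cvgrPdist_le: m1 => /(_ _ e20) m1.
move/cvgrPdist_le: m2 => /(_ _ e20) m2.
near=> n.
have l1 : `|a1 - (\sum_(k < n) f1 k) / n%:R| <= e / 2 by near: n.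
have l2 : `|a2 - (\sum_(k < n) f2 k) / n%:R| <= e / 2 by near: n.
have le1 : (\sum_(k < n) f1 k) / n%:R <= (\sum_(k < n) f k) / n%:R.
  apply: ler_wpM2r; first by rewrite invr_ge0.
  by apply: ler_sum => k _; case/andP: (ff k).
have le2 : (\sum_(k < n) f k) / n%:R <= (\sum_(k < n) f2 k) / n%:R.
  apply: ler_wpM2r; first by rewrite invr_ge0.
  by apply: ler_sum => k _; case/andP: (ff k).
move: l1 l2; rewrite !ler_norml => /andP[? ?] /andP[? ?].
by apply/andP; split; lra.
Unshelve. all: by end_near. Qed.

Lemma has_mean_indicP (A : set nat) a :
  has_mean (\1_A : nat -> R) a <-> has_density R A /\ density R A = a.
Proof.
have E : density_seq R A = fun n => (\sum_(k < n) (\1_A k : R)) / n%:R.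
  apply/funext => n; rewrite /density_seq; congr (_ / _).
  have -> : #|` fset_set (A `&` `I_n)| = count (fun k => k \in A) (iota 0 n).
    rewrite -size_filter; apply/perm_size/uniq_perm.
    - exact: fset_uniq.
    - exact/filter_uniq/iota_uniq.
    - move=> x; rewrite in_fset_set; last first.
        by apply: finite_setI; right; exact: finite_II.
      rewrite in_setI mem_filter mem_iota add0n leq0n /=; congr (_ && _).
      by apply/idP/idP => [/set_mem|xn]; [|exact/mem_set].
  rewrite -(big_mkord xpredT (\1_A : nat -> R)) -sum1_count natr_sum.
  rewrite /index_iota subn0 big_mkcond /=.
  by apply: eq_bigr => k _; rewrite indicE; case: ifP.
rewrite /has_mean /has_density /density /= E; split => [cva|[cva <-]//].
split; first exact: cvgP cva.
exact: (cvg_lim (@Rhausdorff R)).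
Qed.

End CesaroMean.

(** * Independent indexed families *)

Section IndexedIndependence.
Variable R : realType.

Lemma prod_indic (I : Type) (a : I -> set nat) (s : seq I) n :
  \prod_(i <- s) (\1_(a i) n : R) = (all (fun i => n \in a i) s)%:R.
Proof.
elim: s => [|i s IH]; first by rewrite big_nil.
by rewrite big_cons IH indicE /= -natrM mulnb.
Qed.

Lemma indic_bigcap (F : {fset set nat}) n :
  \1_(\bigcap_(B in [set` F]) B) n = \prod_(B <- F) (\1_B n : R).
Proof.
rewrite (prod_indic id) indicE.
suff -> : (n \in \bigcap_(B in [set` F]) B) =
  all (fun B : set nat => n \in B) F by [].
apply/idP/allP => [/set_mem H B BF|H].
  by apply: mem_set; exact: H.
by apply/mem_set => B BF; apply/set_mem/H.
Qed.

(* Lets one extend a property from finite intersections to the whole generated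
   field without any normal form for its members. *)
Lemma generated_field_indic (A : set (set nat)) (L : set (nat -> R)) :
  L (fun=> 1) ->
  (forall f g, L f -> L g -> L (fun n => f n - g n)) ->
  (forall B f, A B -> L f -> L (fun n => \1_B n * f n)) ->
  forall Y, generated_field A Y -> L \1_Y.
Proof.
move=> L1 LB LM Y AY.
pose M := [set Y : set nat | forall f, L f -> L (fun n => \1_Y n * f n)].
have fieldM : field_of_sets M.
  have MC : setC_closed M.
    move=> X MX f Lf.
    rewrite (_ : (fun _ => _) = (fun n => f n - \1_X n * f n)).
      by apply: LB => //; exact: MX.
    apply/funext => n; rewrite !indicE in_setC.
    by case: (n \in X) => /=; ring.
  split => //.
  - by move=> f; rewrite indicT; under eq_fun do rewrite /= mul1r.
  - move=> X X' MX MX' f Lf; rewrite -(setCK (X `|` X')) setCU.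
    apply: (MC) => // {Lf}f Lf; rewrite indicI.
    by under eq_fun do rewrite /= -mulrA; apply/MC/MC.
have /(_ _ AY) MY : generated_field A `<=` M.
  by apply: smallest_sub => // B AB f Lf; apply: LM.
by have := MY _ L1; under eq_fun do rewrite mulr1.
Qed.

Lemma generated_field_field (A : set (set nat)) :
  field_of_sets (generated_field A).
Proof.
split.
- by move=> X [[]].
- move=> X Y AX AY Z ZA; case: (ZA) => -[_ ZU _] _.
  by apply: ZU; [exact: AX|exact: AY].
- by move=> X AX Z ZA; case: (ZA) => -[_ _ ZC] _; apply: ZC; exact: AX.
Qed.

(** The empty [F] is covered as well. Otherwise the mean exists because a generated field is closed
    under finite intersections. *)
Lemma d_independent_has_mean (A : set (set nat)) (F : {fset set nat}) :
  d_independent R A -> [set` F] `<=` A ->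
  has_mean (fun n => \prod_(B <- F) \1_B n) (\prod_(B <- F) density R B).
Proof.
move=> [[_ AD] _ gen prod] FA.
have [->|F0] := eqVneq F fset0.
  rewrite big_seq_fset0; apply: eq_has_mean (@has_mean1 R) => n.
  by rewrite big_seq_fset0.
have fin : finite_set [set` F] by exact: finite_fset.
have /(prod _) : [set` F] !=set0 by case/fset0Pn: F0 => B BF; exists B.
move=> /(_ fin FA); rewrite set_fsetK => <-.
apply: (@eq_has_mean _ \1_(\bigcap_(B in [set` F]) B)).
  exact: indic_bigcap.
apply/has_mean_indicP; split=> //; apply: gen.
have [GT GU GC] := generated_field_field A.
rewrite bigcap_fset big_seq; elim/big_ind: _ => //.
- move=> X Y GX GY; rewrite -(setCK (X `&` Y)) setCI.
  by apply: (GC); apply: (GU); [exact: (GC _ GX)|exact: (GC _ GY)].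
- by move=> B BF; apply: sub_gen_smallest; exact: FA.
Qed.

Section Family.
Variables (I : choiceType) (D : set I) (a : I -> set nat) (p : I -> R).

(** A set occurring at two indices is counted twice; with all [p i] in (0, 1) this forces [a] to be
    injective on [D]. *)
Definition independent :=
  forall F : {fset I}, [set` F] `<=` D ->
  has_mean (fun n => \prod_(i <- F) \1_(a i) n) (\prod_(i <- F) p i).

Hypothesis ap : independent.

Lemma independent_has_mean i : D i -> has_mean (\1_(a i)) (p i).
Proof.
move=> Di; have := ap (F := [fset i]%fset).
rewrite big_seq_fset1 => H; apply: eq_has_mean (H _) => [n|j].
  by rewrite big_seq_fset1.
by rewrite /= inE => /eqP ->.
Qed.

(** [Q] is any subring. The functions whose products with all finite products of members have means
    in [Q] include 1 and are closed under differences and under multiplication by the indicator of a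
    member. *)
Lemma independent_generated (Q : set R) :
  Q 1 -> (forall x y, Q x -> Q y -> Q (x - y)) ->
  (forall x y, Q x -> Q y -> Q (x * y)) -> (forall i, D i -> Q (p i)) ->
  forall Y, generated_field (a @` D) Y -> exists2 m, Q m & has_mean (\1_Y) m.
Proof.
move=> Q1 QB QM Qp Y AY.
pose L := [set f : nat -> R | forall F : {fset I}, [set` F] `<=` D ->
  exists2 m, Q m & has_mean (fun n => f n * \prod_(i <- F) \1_(a i) n) m].
suff : L \1_Y.
  move=> /(_ fset0) [x|m Qm mY]; first by rewrite /= inE.
  exists m => //; apply: eq_has_mean mY => n.
  by rewrite big_seq_fset0 mulr1.
apply: (generated_field_indic (L := L) _ _ _ AY).
- move=> F FD; exists (\prod_(i <- F) p i).
    rewrite big_seq; elim/big_ind: _ => // i iF; exact/Qp/FD.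
  by apply: eq_has_mean (ap FD) => n; rewrite mul1r.
- move=> f g Lf Lg F FD; have [m Qm fm] := Lf F FD; have [k Qk gk] := Lg F FD.
  exists (m - k); first exact: QB.
  by apply: eq_has_mean (has_meanB fm gk) => n; rewrite mulrBl.
- move=> _ f [i Di <-] Lf F FD.
  (* Indicators are idempotent, so a factor already in [F] is absorbed; a new one enlarges [F]. *)
  have [iF|iF] := boolP (i \in F).
    have [m Qm fm] := Lf F FD; exists m => //; apply: eq_has_mean fm => n.
    rewrite (big_fsetD1 i)//= !indicE; case: (n \in a i) => /=; ring.
  have [|m Qm fm] := Lf (i |` F)%fset.
    by move=> j; rewrite /= !inE => /orP[/eqP->//|/FD].
  exists m => //; apply: eq_has_mean fm => n.
  by rewrite big_fsetU1//=; ring.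
Qed.

Hypothesis p01 : forall i, D i -> 0 < p i < 1.

Lemma independent_inj i j : D i -> D j -> a i = a j -> i = j.
Proof.
move=> Di Dj aij; apply/eqP/negPn/negP => ij.
have pi := independent_has_mean Di; have pj := independent_has_mean Dj.
have := ap (F := [fset i; j]%fset).
rewrite big_fsetU1 ?inE// big_seq_fset1 => H.
have : has_mean (\1_(a i)) (p i * p j).
  apply: eq_has_mean (H _) => [n|k]; last by rewrite /= !inE => /orP[]/eqP->.
  rewrite big_fsetU1 ?inE// big_seq_fset1 -aij !indicE /= -natrM mulnb andbb.
  by [].
move=> /(has_mean_unique pi) E.
have := p01 Di; have := p01 Dj => /andP[_ pj1] /andP[pi0 _].
by move: pj1; rewrite -(ltr_pM2l pi0) -E mulr1 ltxx.
Qed.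

Lemma independent_d_independent : D !=set0 -> d_independent R (a @` D).
Proof.
move=> [i0 Di0].
have dens i : D i -> density R (a i) = p i.
  by move=> /independent_has_mean /has_mean_indicP[].
have gen : generated_field (a @` D) `<=` has_density R.
  move=> Y /(@independent_generated setT) [] // m _ /has_mean_indicP[]//.
split => //.
- split; first by exists (a i0), i0.
  by move=> _ [i Di <-]; have /has_mean_indicP[] := independent_has_mean Di.
- by move=> _ [i Di <-]; rewrite dens//; exact: p01.
move=> F _ finF FA.
(* [g] picks an index for each member, turning products over sets into products over indices. *)
pose g B := xget i0 [set i | D i /\ a i = B].
have gP B : B \in fset_set F -> D (g B) /\ a (g B) = B.
  rewrite in_fset_set// => /set_mem /FA [i Di aiB].
  exact: (@xgetPex _ i0 [set i | D i /\ a i = B]) (ex_intro _ i (conj Di aiB)).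
have ginj : {in fset_set F &, injective g}.
  by move=> B B' /gP[_ BE] /gP[_ BE'] gE; rewrite -BE -BE' gE.
have GD : [set` [fset g B | B in fset_set F]%fset] `<=` D.
  by move=> _ /= /imfsetP[/= B BF ->]; have [] := gP _ BF.
have -> : \prod_(B <- fset_set F) density R B =
          \prod_(i <- [fset g B | B in fset_set F]%fset) p i.
  rewrite big_imfset//= big_seq [RHS]big_seq; apply: eq_bigr => B /gP[DB aB].
  by rewrite -dens// aB.
suff /has_mean_indicP[] : has_mean (\1_(\bigcap_(B in F) B))
    (\prod_(i <- [fset g B | B in fset_set F]%fset) p i) by [].
apply: eq_has_mean (ap GD) => n.
rewrite -[in RHS](fset_setK finF) indic_bigcap big_imfset//=.
by rewrite big_seq [RHS]big_seq; apply: eq_bigr => B /gP[_ ->].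
Qed.

(** Supplies the hypothesis on [Z r] under which a row can be collapsed. *)
Lemma independent_extension (A : set (set nat)) B :
  d_independent R A -> a @` D `<=` A -> A B -> ~ (a @` D) B ->
  forall F : {fset I}, [set` F] `<=` D ->
  has_mean (fun n => \1_B n * \prod_(i <- F) \1_(a i) n)
           (density R B * \prod_(i <- F) p i).
Proof.
move=> Aind DA AB nB F FD.
have ainj : {in F &, injective a}.
  by move=> i j /FD Di /FD Dj; exact: independent_inj.
have nBF : B \notin [fset a i | i in F]%fset.
  by apply/negP => /imfsetP[/= i iF BE]; apply: nB; exists i => //; exact: FD.
have FA : [set` (B |` [fset a i | i in F])%fset] `<=` A.
  move=> C; rewrite /= !inE => /orP[/eqP->//|/imfsetP[/= i iF ->]].
  by apply: DA; exists i => //; exact: FD.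
have := d_independent_has_mean Aind FA.
rewrite big_fsetU1//= big_imfset//=.
have -> : \prod_(i <- F) density R (a i) = \prod_(i <- F) p i.
  rewrite big_seq [RHS]big_seq; apply: eq_bigr => i /FD Di.
  by have /has_mean_indicP[] := independent_has_mean Di.
by apply: eq_has_mean => n; rewrite big_fsetU1//= big_imfset.
Qed.

End Family.
End IndexedIndependence.

(** * Continuum many independent sets of density 1/2 *)

(* [prefix_code f n] is the number with binary digits [1 f(0) ... f(n-1)], so that
   prefixes of points of the Cantor space are coded injectively. *)
Fixpoint prefix_code (f : nat -> bool) (n : nat) : nat :=
  if n is m.+1 then (prefix_code f m).*2 + f m else 1%N.

Lemma prefix_code_bounds f n : (2 ^ n <= prefix_code f n < 2 ^ n.+1)%N.
Proof.
elim: n => [//|n /andP[h1 h2]]; rewrite /= expnS (expnS 2 n.+1).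
by case: (f n); lia.
Qed.

Lemma prefix_code_inj f g m n : prefix_code f m = prefix_code g n ->
  m = n /\ forall i, (i < n)%N -> f i = g i.
Proof.
elim: m n => [|m IH] [|n] //=.
- by have /andP[] := prefix_code_bounds g n; lia.
- by have /andP[] := prefix_code_bounds f m; lia.
move=> E; have fg : f m = g n.
  by have := congr1 odd E; rewrite !oddD !odd_double; case: (f m); case: (g n).
have /IH[-> H] : prefix_code f m = prefix_code g n by move: E; rewrite fg; lia.
split=> // i; rewrite ltnS leq_eqVlt => /predU1P[->|/H//].
have mn : m = n by apply: (proj1 (IH n _)); move: E; rewrite fg; lia.
by rewrite -[in LHS]mn.
Qed.

Definition bit (j n : nat) : bool := odd (n %/ 2 ^ j).

Lemma bitD c L j k : (c < L)%N -> bit c (j * 2 ^ L + k) = bit c k.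
Proof.
move=> cL; rewrite /bit -(subnK (ltnW cL)) expnD mulnA divnMDl ?expn_gt0//.
rewrite oddD oddM oddX -subn_gt0 in cL *.
by rewrite subn_eq0 leqNgt -subn_gt0 cL /= andbF.
Qed.

(** Expanding the right-hand product gives one term for each choice of [L] binary digits, that is,
    for each [k] below [2 ^ L]. The induction splits on the top digit. *)
Lemma sum_prod_bit (R : comPzRingType) (phi : nat -> bool -> R) L :
  \sum_(0 <= k < 2 ^ L) \prod_(0 <= c < L) phi c (bit c k) =
  \prod_(0 <= c < L) (phi c false + phi c true).
Proof.
elim: L => [|L IH]; first by rewrite expn0 big_nat1 !big_geq.
rewrite (big_cat_nat (n := 2 ^ L)) ?leq_exp2l//= big_nat_recr//= -IH.
rewrite mulrDr !mulr_suml; congr (_ + _).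
  apply: eq_big_nat => k /andP[_ kL]; rewrite big_nat_recr//=.
  by rewrite /bit divn_small.
rewrite -{1}(add0n (2 ^ L)%N) big_addn expnS mul2n -addnn addnK.
apply: eq_big_nat => k /andP[_ kL]; rewrite big_nat_recr//=; congr (_ * _).
  apply: eq_big_nat => c /andP[_ cL].
  by rewrite addnC -(@bitD c L 1 k)// mul1n.
by rewrite /bit divnDr ?dvdnn// divnn expn_gt0/= divn_small.
Qed.

Lemma big_fset_ord (R : comPzRingType) (X : {fset nat}) L (g : nat -> R) :
  (forall c, c \in X -> (c < L)%N) ->
  \prod_(0 <= c < L) (if c \in X then g c else 1) = \prod_(c <- X) g c.
Proof.
move=> XL; rewrite -big_mkcond -big_filter; apply/perm_big/uniq_perm.
- exact/filter_uniq/iota_uniq.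
- exact: fset_uniq.
- move=> c; rewrite mem_filter mem_index_iota.
  by have [/XL ->|] := boolP (c \in X).
Qed.

(** Over an aligned block of length [2 ^ L] the low [L] digits take each pattern exactly once, so
    distinct positions behave as independent fair coins. *)
Lemma sum_prod_bit_block (R : realType) (I : choiceType) (F : {fset I})
    (c : I -> nat) L j :
  {in F &, injective c} -> (forall i, i \in F -> (c i < L)%N) ->
  \sum_(j * 2 ^ L <= k < j.+1 * 2 ^ L) \prod_(i <- F) ((bit (c i) k)%:R : R) =
  (2 ^ L)%:R * \prod_(i <- F) 2^-1.
Proof.
move=> cinj cL; pose X := [fset c i | i in F]%fset.
have XL n : n \in X -> (n < L)%N by move=> /imfsetP[/= i /cL + ->].
rewrite -{1}(add0n (j * 2 ^ L)%N) big_addn mulSn addnK.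
pose phi n (b : bool) : R := if n \in X then b%:R else 1.
transitivity (\sum_(0 <= k < 2 ^ L) \prod_(0 <= n < L) phi n (bit n k)).
  apply: eq_big_nat => k _; rewrite big_fset_ord// big_imfset//=.
  rewrite big_seq [RHS]big_seq; apply: eq_bigr => i /cL iL.
  by rewrite addnC bitD.
rewrite sum_prod_bit.
transitivity (\prod_(0 <= n < L) (2 * (if n \in X then 2^-1 else 1) : R)).
  apply: eq_bigr => n _; rewrite /phi; case: ifP => _; last by rewrite mulr1.
  by rewrite add0r divff.
rewrite big_split /= big_fset_ord// big_imfset//=; congr (_ * _).
by rewrite prodr_const_nat subn0 natrX.
Qed.

(** * Means of functions balanced on blocks of slowly growing length *)

Definition level (n : nat) : nat := (trunc_log 2 (trunc_log 2 n)).-1.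

Lemma tower_sqr m : ((2 ^ (2 ^ m)) ^ 2 = 2 ^ (2 ^ m.+1))%N.
Proof. by rewrite (expnS 2 m) mulnC expnM. Qed.

Lemma tower_quad m : ((2 ^ (2 ^ m)) ^ 4 = 2 ^ (2 ^ m.+2))%N.
Proof. by rewrite (expnM _ 2 2) !tower_sqr. Qed.

(** The predecessor in [level] keeps [n] at or above the square of the block length, so that one
    block is negligible against [n]. *)
Lemma level_bounds n : (4 <= n)%N ->
  ((2 ^ (2 ^ level n)) ^ 2 <= n < (2 ^ (2 ^ level n)) ^ 4)%N.
Proof.
move=> n4; have n0 : (0 < n)%N by exact: leq_trans n4.
have t2 : (2 <= trunc_log 2 n)%N by apply: trunc_log_max.
have t1 : (1 <= trunc_log 2 (trunc_log 2 n))%N by apply: trunc_log_max.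
rewrite tower_sqr tower_quad /level prednK//.
have /andP[a1 a2] := trunc_log_bounds (isT : (1 < 2)%N) n0.
have /andP[b1 b2] := trunc_log_bounds (isT : (1 < 2)%N) (ltnW t2).
rewrite (leq_trans _ a1) ?leq_exp2l//=.
by apply: leq_trans a2 _; rewrite leq_exp2l.
Qed.

Lemma level_eq m n :
  ((2 ^ (2 ^ m)) ^ 2 <= n < (2 ^ (2 ^ m)) ^ 4)%N -> level n = m.
Proof.
rewrite tower_sqr tower_quad => /andP[h1 h2].
have n0 : (0 < n)%N by apply: leq_trans h1; rewrite expn_gt0.
rewrite /level (@trunc_log_eq 2 m.+1)//; apply/andP; split.
  exact: trunc_log_max.
have := trunc_logP (isT : (1 < 2)%N) n0 => /leq_ltn_trans /(_ h2).
by rewrite ltn_exp2l.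
Qed.

Section BlockMean.
Variables (R : realType) (g : nat -> R) (q : R) (m0 : nat).
Let P m := (2 ^ (2 ^ m))%N.
Hypothesis g01 : forall n, 0 <= g n <= 1.
Hypothesis q01 : 0 <= q <= 1.
Hypothesis g_block : forall m j, (m0 <= m)%N -> (P m <= j < P m ^ 3)%N ->
  \sum_(j * P m <= k < j.+1 * P m) g k = (P m)%:R * q.

Let S n : R := \sum_(0 <= k < n) g k - n%:R * q.

Let PS m : P m.+1 = (P m ^ 2)%N.
Proof. by rewrite /P expnS mulnC expnM. Qed.

Let P_gt0 m : (0 < P m)%N. Proof. by rewrite expn_gt0. Qed.

Let P_ge m : (m <= P m)%N.
Proof.
by apply: leq_trans (ltnW (ltn_expl _ _)) (ltnW (ltn_expl _ _)).
Qed.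

Let S_step m j : (m0 <= m)%N -> (P m <= j < P m ^ 3)%N ->
  S (j.+1 * P m) = S (j * P m).
Proof.
move=> mm jm; rewrite /S (big_cat_nat (n := (j * P m)%N))//=; last first.
  by rewrite leq_mul2r leqnSn orbT.
rewrite g_block// mulSn natrD; ring.
Qed.

(** A full block leaves [S] unchanged, and the blocks of level [m] end at [P m ^ 4 = P m.+1 ^ 2],
    where those of the next level start. *)
Let S_block m j : (m0 <= m)%N -> (P m <= j <= P m ^ 3)%N ->
  S (j * P m) = S (P m0 ^ 2).
Proof.
move=> /subnKC <-; elim: (m - m0)%N j => [|i IH].
  rewrite addn0 => j /andP[/subnKC <-]; elim: (j - P m0)%N => [|d IHd] dP.
    by rewrite addn0 mulnn.
  rewrite addnS S_step// -?addnS ?leq_addr//.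
  by apply: IHd; apply: leq_trans dP; rewrite leq_add2l.
move=> j /andP[/subnKC <-]; elim: (j - P (m0 + i.+1))%N => [|d IHd] dP.
  rewrite addn0 addnS PS mulnn -expnM (_ : (2 * 2 = 4)%N)// expnSr IH//.
  by rewrite leqnn andbT -{1}(expn1 (P _)) leq_pexp2l.
rewrite addnS S_step// ?leq_addr// -?addnS ?leq_addr//.
by apply: IHd; apply: leq_trans dP; rewrite leq_add2l.
Qed.

Let S_diff n k : (k <= n)%N -> `|S n - S k| <= (n - k)%:R.
Proof.
move=> kn; rewrite /S (big_cat_nat (n := k))//=.
have h0 : 0 <= \sum_(k <= i < n) g i.
  by apply: sumr_ge0 => i _; case/andP: (g01 i).
have h1 : \sum_(k <= i < n) g i <= (n - k)%:R.
  rewrite -[leRHS]mulr1 mulr_natl -sumr_const_nat.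
  by apply: ler_sum => i _; case/andP: (g01 i).
have : 0 <= (n - k)%:R * q <= (n - k)%:R.
  case/andP: q01 => q0 q1; rewrite mulr_ge0//= -[leRHS]mulr1.
  exact: ler_wpM2l.
rewrite natrB// => /andP[]; rewrite ler_norml => h2 h3; apply/andP.
split; move: h1; rewrite natrB//; lra.
Qed.

(** Since the last block end [S] has moved by at most [P m], while [n] is at least [P m ^ 2]; so
    [S n / n] is at most [c / P m] in absolute value. *)
Lemma has_mean_blocks : has_mean g q.
Proof.
pose c := `|S (P m0 ^ 2)| + 1.
have c0 : 0 < c by rewrite ltr_wpDl.
apply/cvgrPdist_le => e e0.
(* Large enough that [c <= e * P m] for all [m >= M], by [m <= P m]. *)
pose M := maxn m0 (Num.truncn (c / e)).+1.
near=> n.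
have nM : (P M ^ 2 <= n)%N by near: n; exact: nbhs_infty_ge.
have n0 : (0 < n)%N by apply: leq_trans nM; rewrite expn_gt0 P_gt0.
have [m [Mm mn nm]] : exists m, [/\ (M <= m)%N, (P m ^ 2 <= n)%N & (n < P m ^ 4)%N].
  have n4 : (4 <= n)%N.
    apply: leq_trans nM; rewrite -PS /P (_ : 4 = 2 ^ (2 ^ 1))%N//.
    by rewrite !leq_exp2l.
  have /andP[l1 l2] := level_bounds n4; exists (level n); split => //.
  rewrite leqNgt; apply/negP => lM; move: l2; rewrite ltnNge.
  apply/negP/negPn; apply: leq_trans nM.
  by rewrite /P tower_sqr tower_quad !leq_exp2l.
pose j := (n %/ P m)%N.
have jP : (P m <= j <= P m ^ 3)%N.
  rewrite leq_divRL// mulnn mn /= -ltnS ltn_divLR//.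
  by apply: leq_trans nm _; rewrite mulSn -expnSr leq_addl.
have m0m : (m0 <= m)%N by apply: leq_trans Mm; exact: leq_maxl.
have Sn : `|S n| <= c * (P m)%:R.
  rewrite -(subrK (S (j * P m)) (S n)) (le_trans (ler_normD _ _))//.
  apply: le_trans (lerD (S_diff (leq_divM _ _)) (lexx _)) _.
  rewrite [S (j * P m)]S_block//.
  have := ltn_mod n (P m); rewrite P_gt0 => nP.
  have /ltW : (n - j * P m)%:R < (P m)%:R :> R.
    by rewrite ltr_nat {1}(divn_eq n (P m)) addKn.
  have : `|S (P m0 ^ 2)| <= `|S (P m0 ^ 2)| * (P m)%:R.
    by rewrite ler_peMr// ler1n.
  by rewrite /c; lra.
rewrite distrC.
have -> : (\sum_(k < n) g k) / n%:R - q = S n / n%:R.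
  by rewrite /S big_mkord; field; rewrite pnatr_eq0 -lt0n.
rewrite normrM normfV (ger0_norm (ler0n _ n)) ler_pdivrMr ?ltr0n//.
apply: le_trans Sn _.
have : (P m ^ 2)%:R <= n%:R :> R by rewrite ler_nat.
have : c <= e * (P m)%:R.
  rewrite mulrC -ler_pdivrMr//; apply/ltW.
  apply: lt_le_trans (truncnS_gt _) _; rewrite ler_nat.
  apply: leq_trans (P_ge m); apply: leq_trans Mm; exact: leq_maxr.
move=> h1 h2; apply: (@le_trans _ _ (e * (P m)%:R * (P m)%:R)).
  exact: ler_wpM2r.
by rewrite -mulrA -natrM mulnn; apply: ler_wpM2l => //; exact: ltW.
Unshelve. all: by end_near. Qed.

End BlockMean.

(* The bit position read at [n] must be constant on long stretches, hence the
   iterated logarithm in [level]. *)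
Definition bit_set (f : nat -> bool) : set nat :=
  [set n | bit (prefix_code f (level n).-1) n].

Lemma separating_prefix (I : choiceType) (f : I -> nat -> bool) (F : {fset I}) :
  {in F &, injective f} -> exists N, forall m, (N <= m)%N ->
  {in F &, injective (fun i => prefix_code (f i) m)}.
Proof.
move=> finj.
have [d dP] : exists d : I -> I -> nat, forall i j, i \in F -> j \in F -> i != j ->
    f i (d i j) != f j (d i j).
  have /choice[d dP] : forall ij : I * I, exists d, ij.1 \in F -> ij.2 \in F ->
      ij.1 != ij.2 -> f ij.1 d != f ij.2 d.
    case=> i j /=.
    have [ij|] := pselect (exists d, f i d != f j d).
      by have [d dij] := ij; exists d.
    move=> /forallNP H; exists 0%N => iF jF /eqP[]; apply: finj => //.
    by apply/funext => d; apply/eqP/negPn/negP/H.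
  by exists (fun i j => d (i, j)) => i j; exact: (dP (i, j)).
(* A crude bound above every separating position [d i j]. *)
exists (\sum_(i <- F) \sum_(j <- F) (d i j).+1)%N => m Nm.
move=> i j iF jF /prefix_code_inj[_ H].
apply/eqP/negPn/negP => ij; have /negP[] := dP _ _ iF jF ij.
apply/eqP/H; apply: leq_trans Nm.
by rewrite (big_fsetD1 i)//= (big_fsetD1 j)//= -addnA leq_addr.
Qed.

(** At level [m] each set reads the digit whose position codes a prefix of length [m - 1]. For large
    [m] these positions are distinct, and they are below [2 ^ m], so each block of length
    [2 ^ (2 ^ m)] is balanced. *)
Lemma bit_set_independent (R : realType) (I : choiceType) (f : I -> nat -> bool) :
  injective f -> independent setT (fun i => bit_set (f i)) (fun=> 2^-1 : R).
Proof.
move=> finj F _; have [N HN] := separating_prefix (F := F) (in2W finj).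
apply: (@has_mean_blocks _ _ _ N.+1).
- move=> n; rewrite (prod_indic _ (fun i => bit_set (f i))).
  by case: all; rewrite ?lexx ?ler01.
- have h2 : 0 <= (2^-1 : R) <= 1.
    by rewrite invr_ge0 ler0n invf_le1 ?ltr0n// ler1n.
  by rewrite prodr_ile1// prodr_ge0// => i _; case/andP: h2.
move=> m j Nm jm; have m0 : (0 < m)%N by exact: leq_ltn_trans Nm.
rewrite -(@sum_prod_bit_block _ _ _ (fun i => prefix_code (f i) m.-1) _ j).
- apply: eq_big_nat => k kj; apply: eq_bigr => i _; rewrite indicE.
  have -> : (k \in bit_set (f i)) = bit (prefix_code (f i) (level k).-1) k.
    by apply/idP/idP => [/set_mem|/mem_set].
  rewrite (@level_eq m)//; case/andP: kj => k1 k2; case/andP: jm => j1 j2.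
  rewrite (leq_trans _ k1) /=; last by rewrite -mulnn leq_mul2r j1 orbT.
  by apply: leq_trans k2 _; rewrite expnSr leq_mul2r j2 orbT.
- by apply: HN; rewrite -ltnS prednK.
- move=> i _; have /andP[_] := prefix_code_bounds (f i) m.-1.
  by rewrite prednK.
Qed.

(** * Prescribing densities by binary digits *)

Section BinaryExpansion.
Variable R : realType.
Implicit Types (e : nat -> bool) (t : R).

Definition digit_sum e K : R := \sum_(0 <= k < K) (e k)%:R * 2 ^- k.+1.

Definition expands e t :=
  forall K, digit_sum e K <= t <= digit_sum e K + 2 ^- K.

Lemma exp2VS k : 2 ^- k = 2 ^- k.+1 + 2 ^- k.+1 :> R.
Proof. by rewrite exprS invfM; lra. Qed.

Lemma exp2V_gt0 k : 0 < 2 ^- k :> R.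
Proof. by rewrite invr_gt0 exprn_gt0. Qed.

Lemma exp2V_small (c x : R) : 0 < x -> exists K, c * 2 ^- K <= x.
Proof.
move=> x0; exists (Num.truncn (c / x)).+1; set K := _.+1.
rewrite ler_pdivrMr ?exprn_gt0// mulrC -ler_pdivrMr//.
apply/ltW/(lt_trans (truncnS_gt _)).
by rewrite -natrX ltr_nat ltn_expl.
Qed.

Lemma digit_sumS e K : digit_sum e K.+1 = digit_sum e K + (e K)%:R * 2 ^- K.+1.
Proof. by rewrite /digit_sum big_nat_recr. Qed.

Lemma digit_sum_bounds e K d :
  digit_sum e K <= digit_sum e (K + d) <= digit_sum e K + 2 ^- K - 2 ^- (K + d).
Proof.
elim: d => [|d /andP[h1 h2]]; first by rewrite addn0 addrK lexx.
rewrite addnS digit_sumS; have := exp2VS (K + d); have := exp2V_gt0 (K + d).+1.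
by case: (e _) => /= ? ?; apply/andP; split; lra.
Qed.

Lemma digits_exist t : 0 <= t <= 1 -> exists e, expands e t.
Proof.
(* The doubling map, whose orbit yields the digits. It preserves the closed interval [0, 1]; the
   fixed point 1 is expanded by ones only. *)
move=> t01; pose step (r : R) := 2 * r - (2^-1 <= r)%R%:R.
pose r k := iter k step t; pose e k := 2^-1 <= r k.
have r01 k : 0 <= r k <= 1.
  elim: k => [//|k /andP[h1 h2]]; rewrite /r iterS -/(r k) /step.
  by have [|] := leP 2^-1 (r k) => /= ?; apply/andP; split; lra.
have tE k : t = digit_sum e k + r k * 2 ^- k.
  elim: k => [|k IH]; first by rewrite /digit_sum big_geq// add0r expr0 invr1 mulr1.
  rewrite digit_sumS {1}IH /r iterS -/(r k) /step exp2VS.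
  by rewrite -/(e k); ring.
exists e => k; rewrite {1 2}(tE k).
have := exp2V_gt0 k; have /andP[? ?] := r01 k => ?.
by rewrite lerDl lerD2l mulr_ge0 ?ler_piMl// ltW.
Qed.

Lemma expansion_exists e : exists t, expands e t.
Proof.
pose A := range (digit_sum e).
have ubA K : ubound A (digit_sum e K + 2 ^- K).
  move=> _ [n _ <-]; have [nK|Kn] := leqP n K.
    have := digit_sum_bounds e n (K - n); rewrite subnKC// => /andP[h1 _].
    by apply: le_trans h1 _; rewrite lerDl ltW// exp2V_gt0.
  have := digit_sum_bounds e K (n - K); rewrite subnKC ?(ltnW Kn)// => /andP[_ h].
  by apply: le_trans h _; rewrite gerDl oppr_le0 ltW// exp2V_gt0.
exists (sup A) => K; apply/andP; split.
  by apply: ub_le_sup; [exists (digit_sum e 0 + 2 ^- 0)|exists K].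
by apply: ge_sup => //; exists (digit_sum e 0), 0%N.
Qed.

End BinaryExpansion.

(* If the sets [C j] are independent of density 1/2, the first [j] with
   [n \notin C j] has the geometric distribution, so this set has density
   [\sum_k e_k 2^-(k+1)]. *)
Definition digit_set (C : nat -> set nat) (e : nat -> bool) : set nat :=
  [set n | exists k, [/\ e k, ~ C k n & forall j, (j < k)%N -> C j n]].

Section DigitSetMean.
Variable R : realType.
Variables (C : nat -> set nat) (e : nat -> bool) (t : R).
Hypothesis et : expands e t.

Let c k n : R := \prod_(0 <= j < k) \1_(C j) n.
Let u k n : R := \sum_(0 <= j < k) (e j)%:R * (c j n - c j.+1 n).

Let uS j n : u j.+1 n = u j n + (e j)%:R * (c j n - c j.+1 n).
Proof. by rewrite /u big_nat_recr. Qed.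

(** After [k] tests either [n] lies in every tested [C j] and is undecided, or [u k n] already has
    its final value. *)
Let digit_set_approx k n :
  (c k n = 1 /\ u k n = 0 /\ forall j, (j < k)%N -> C j n) \/
  (c k n = 0 /\ u k n = \1_(digit_set C e) n).
Proof.
have cS j : c j.+1 n = c j n * \1_(C j) n by rewrite /c big_nat_recr.
elim: k => [|k [[c1 [u0 Ck]]|[c0 uk]]].
- by left; rewrite /c /u !big_geq.
- rewrite uS cS c1 u0 indicE; have [kn|kn] := boolP (n \in C k).
    left; rewrite mulr1 subrr mulr0 addr0; split=> //; split=> // j.
    by rewrite ltnS leq_eqVlt => /predU1P[->|/Ck//]; exact: set_mem.
  right; rewrite mulr0 subr0 mulr1 add0r indicE; split=> //.
  congr (_ %:R); congr nat_of_bool; apply/idP/idP => [ek|].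
    apply/mem_set; exists k; split => //.
    by move=> /mem_set; rewrite (negPf kn).
  move=> /set_mem[j [ej nj Cj]]; suff -> : k = j by [].
  apply/eqP; rewrite eqn_leq; apply/andP; split; rewrite leqNgt; apply/negP.
    by move=> /Ck.
  by move=> /Cj /mem_set; rewrite (negPf kn).
- by right; rewrite uS cS c0 uk mul0r subrr mulr0 addr0.
Qed.

(** The undecided points contribute only [m * 2 ^- k], which allows squeezing between [g * u] and
    [g * (u + c)]. The factor [g] carries the other sets of an intersection. *)
Lemma digit_set_has_mean (g : nat -> R) m :
  (forall n, 0 <= g n) -> 0 <= m ->
  (forall k, has_mean (fun n => g n * \prod_(0 <= j < k) \1_(C j) n) (m * 2 ^- k)) ->
  has_mean (fun n => g n * \1_(digit_set C e) n) (m * t).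
Proof.
move=> g0 m0 gC; apply: has_mean_squeeze => x x0.
have [K mK] := exp2V_small m x0.
have guK : has_mean (fun n => g n * u K n) (m * digit_sum R e K).
  elim: K {mK} => [|K IH].
    rewrite /digit_sum big_geq// mulr0; apply: eq_has_mean (@has_mean0 R) => n.
    by rewrite /u big_geq// mulr0.
  have H := has_meanD IH (has_meanZ (c := (e K)%:R) (has_meanB (gC K) (gC K.+1))).
  rewrite digit_sumS mulrDr.
  have -> : m * ((e K)%:R * 2 ^- K.+1) = (e K)%:R * (m * 2 ^- K - m * 2 ^- K.+1).
    by rewrite (exp2VS _ K); ring.
  by apply: eq_has_mean H => n; rewrite uS /c; ring.
have /andP[t1 t2] := et K.
exists (fun n => g n * u K n), (fun n => g n * u K n + g n * c K n),
  (m * digit_sum R e K), (m * digit_sum R e K + m * 2 ^- K); split.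
- move=> n; rewrite -mulrDr.
  case: (digit_set_approx K n) => [[-> [-> _]]|[-> ->]].
    by rewrite !ler_wpM2l// ?add0r indicE; case: (n \in _).
  by rewrite addr0 lexx.
- exact: guK.
- exact: has_meanD guK (gC K).
- have := ler_wpM2l m0 t2; rewrite mulrDr; lra.
- have := ler_wpM2l m0 t1; lra.
Qed.

End DigitSetMean.

(** * Collapsing rows *)

Section RowFamilies.
Variables (R : realType) (Row : choiceType).
Variables (C : Row * nat -> set nat) (Z : Row -> set nat).
Variables (e : Row -> nat -> bool) (w : Row -> R).
Hypothesis C_indep : independent setT C (fun=> 2^-1 : R).
Hypothesis w_ge0 : forall r, 0 <= w r.

(* For [r] in [S] the whole row [C (r, _)] is collapsed to one set, kept at
   index [(r, 0)]. *)
Definition row_set (S : set Row) (i : Row * nat) : set nat :=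
  if i.1 \in S then Z i.1 `&` digit_set (fun j => C (i.1, j)) (e i.1) else C i.

Definition row_dom (S : set Row) : set (Row * nat) := [set i | S i.1 -> i.2 = 0%N].

Definition row_weight (S : set Row) (i : Row * nat) : R :=
  if i.1 \in S then w i.1 else 2^-1.

Definition row_independent (S : set Row) :=
  independent (row_dom S) (row_set S) (row_weight S).

Lemma row_independent0 : row_independent set0.
Proof.
move=> F _; have := C_indep (F := F) (fun _ _ => I).
have -> : \prod_(i <- F) row_weight set0 i = \prod_(i <- F) 2^-1.
  by apply: eq_bigr => i _; rewrite /row_weight in_set0.
apply: eq_has_mean => n.
by apply: eq_bigr => i _; rewrite /row_set in_set0.
Qed.

Lemma chain_finite_union (I : choiceType) (h : I -> Row) (X : set (set Row))
    (G : {fset I}) :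
  X !=set0 -> total_on X subset ->
  exists2 S, X S & forall i, i \in G -> (\bigcup_(S in X) S) (h i) -> S (h i).
Proof.
move=> [S0 XS0] chX; elim/finSet_rect: G => G IH.
have [->|/fset0Pn[i iG]] := eqVneq G fset0; first by exists S0.
have [S XS SP] := IH _ (fproperD1 iG).
have [[S' XS' S'i]|ni] := pselect ((\bigcup_(S in X) S) (h i)); last first.
  exists S => // j jG; have [->//|ji] := eqVneq j i.
  by apply: SP; rewrite !inE ji.
have [SS'|S'S] := chX _ _ XS XS'.
  exists S' => // j jG; have [->//|ji] := eqVneq j i.
  by move=> hj; apply/SS'/SP => //; rewrite !inE ji.
exists S => // j jG; have [->|ji] := eqVneq j i; first by move=> _; exact: S'S.
by apply: SP; rewrite !inE ji.
Qed.

(** Independence concerns finitely many indices at a time, and on these the union of a nonempty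
    chain acts as one of its members; enlarging [S] only shrinks [row_dom S]. *)
Lemma row_independent_bigcup (X : set (set Row)) : total_on X subset ->
  X `<=` row_independent -> row_independent (\bigcup_(S in X) S).
Proof.
move=> chX XP; have [->|/set0P X0] := eqVneq X set0.
  by rewrite bigcup_set0; exact: row_independent0.
move=> F FD; have [S XS SP] := chain_finite_union fst F X0 chX.
have SE i : i \in F -> (i.1 \in S) = (i.1 \in \bigcup_(S in X) S).
  move=> iF; apply/idP/idP => /set_mem Si; apply/mem_set; last exact: SP.
  by exists S.
have FS : [set` F] `<=` row_dom S.
  by move=> i iF Si; apply: FD => //; exists S.
have -> : \prod_(i <- F) row_weight (\bigcup_(S in X) S) i =
          \prod_(i <- F) row_weight S i.
  rewrite big_seq [RHS]big_seq; apply: eq_bigr => i iF.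
  by rewrite /row_weight SE.
apply: eq_has_mean (XP _ XS F FS) => n.
rewrite big_seq [RHS]big_seq; apply: eq_bigr => i iF.
by rewrite /row_set SE.
Qed.

(** The hypothesis on [Z r] covers other members multiplied by any initial segment of the still
    uncollapsed row [r], which is the input that [digit_set_has_mean] needs. *)
Lemma row_independentU1 S r z t : row_independent S -> ~ S r ->
  expands (e r) t -> 0 <= z -> w r = z * t ->
  (forall F : {fset Row * nat}, [set` F] `<=` row_dom S ->
    has_mean (fun n => \1_(Z r) n * \prod_(i <- F) \1_(row_set S i) n)
             (z * \prod_(i <- F) row_weight S i)) ->
  row_independent (r |` S).
Proof.
move=> Sind Sr ert z0 wE ZS F FD.
(* The only index of row [r] left in the new domain is [(r, 0)]; elsewhere sets and weights are
   unchanged. *)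
have old (G : {fset Row * nat}) : [set` G] `<=` row_dom (r |` S) ->
    (r, 0%N) \notin G ->
    [/\ [set` G] `<=` row_dom S, forall i, i \in G -> i.1 != r &
      (\prod_(i <- G) row_weight (r |` S) i = \prod_(i <- G) row_weight S i) /\
      (forall n, \prod_(i <- G) (\1_(row_set (r |` S) i) n : R) =
         \prod_(i <- G) \1_(row_set S i) n)].
  move=> GD rG; have Gr i : i \in G -> i.1 != r.
    move=> iG; apply/eqP => ir; have : i.2 = 0%N by apply: GD => //=; left.
    by move=> i0; move: rG; rewrite -ir -i0 -surjective_pairing iG.
  have rSE i : i \in G -> (i.1 \in r |` S) = (i.1 \in S).
    move=> /Gr/eqP ir; apply/idP/idP => /set_mem; last first.
      by move=> Si; apply/mem_set; right.
    by case=> [/ir//|Si]; apply/mem_set.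
  split=> //; first by move=> i iG Si; apply: GD => //; right.
  split=> [|n]; rewrite big_seq [RHS]big_seq; apply: eq_bigr => i iG.
    by rewrite /row_weight rSE.
  by rewrite /row_set rSE.
have [rF|rF] := boolP ((r, 0%N) \in F); last first.
  have [FS _ [-> FE]] := old _ FD rF.
  by apply: eq_has_mean (Sind _ FS).
pose G := (F `\ (r, 0%N))%fset.
have GD : [set` G] `<=` row_dom (r |` S).
  by move=> i; rewrite /= !inE => /andP[_ /FD].
have rG : (r, 0%N) \notin G by rewrite !inE eqxx.
have [GS Gr [Gw Gset]] := old G GD rG.
rewrite (big_fsetD1 (r, 0%N))//= Gw.
have -> : row_weight (r |` S) (r, 0%N) = z * t.
  by rewrite /row_weight /= mem_set//; left.
rewrite mulrAC.
pose g n : R := \1_(Z r) n * \prod_(i <- G) \1_(row_set S i) n.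
(* [H] is [G] together with [(r, 0)], ..., [(r, k - 1)], all in [row_dom S] because [r] is not in
   [S]. *)
have rows k : exists H : {fset Row * nat}, [/\ [set` H] `<=` row_dom S,
    forall i, i \in H -> i.1 = r -> (i.2 < k)%N,
    \prod_(i <- H) row_weight S i = \prod_(i <- G) row_weight S i * 2 ^- k &
    forall n, \prod_(i <- H) (\1_(row_set S i) n : R) =
      \prod_(i <- G) \1_(row_set S i) n * \prod_(0 <= j < k) \1_(C (r, j)) n].
  elim: k => [|k [H [HS Hr Hw Hset]]].
    exists G; split => //.
    - by move=> i /Gr/eqP.
    - by rewrite expr0 invr1 mulr1.
    - by move=> n; rewrite big_geq// mulr1.
  have rkH : (r, k) \notin H by apply/negP => /Hr /(_ erefl); rewrite ltnn.
  have rS : (r \in S) = false by apply/negP => /set_mem.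
  exists ((r, k) |` H)%fset; split.
  - by move=> i; rewrite /= !inE => /orP[/eqP-> /Sr|/HS].
  - move=> i; rewrite !inE => /orP[/eqP->//|iH ir].
    exact/ltnW/Hr.
  - by rewrite big_fsetU1//= Hw /row_weight /= rS exprSr invfM; ring.
  - move=> n; rewrite big_fsetU1//= Hset big_nat_recr//= /row_set /= rS; ring.
have gmean : has_mean (fun n => g n * \1_(digit_set (fun j => C (r, j)) (e r)) n)
    (z * \prod_(i <- G) row_weight S i * t).
  apply: digit_set_has_mean => //.
  - move=> n; rewrite /g mulr_ge0 ?prodr_ge0 => // *; rewrite indicE; exact: ler0n.
  - rewrite mulr_ge0// prodr_ge0// => i _; rewrite /row_weight.
    by case: ifP => // _; rewrite invr_ge0.
  - move=> k; have [H [HS _ Hw Hset]] := rows k.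
    have := ZS H HS; rewrite Hw mulrA; apply: eq_has_mean => n.
    by rewrite Hset /g mulrA.
apply: eq_has_mean gmean => n.
rewrite (big_fsetD1 (r, 0%N))//= Gset /g /row_set /= mem_set; last by left.
by rewrite indicI /=; ring.
Qed.

Lemma maximal_row_independent (W : set Row) : exists S, [/\ S `<=` W,
  row_independent S & forall r, W r -> ~ S r -> ~ row_independent (r |` S)].
Proof.
have [|S [[SW Sind] Smax]] := @Zorn_bigcup _
  [set S | S `<=` W /\ row_independent S].
  move=> X XP chX; split; first by move=> r [S /XP[SW _] /SW].
  by apply: row_independent_bigcup => // S /XP[].
exists S; split=> // r Wr Sr rind; apply: (Smax (r |` S)); last first.
  by split => // s [->|/SW].
split; first by right.
by move=> /(_ r (or_introl erefl)).
Qed.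

End RowFamilies.

(** * Liouville-like numbers *)

Section LiouvilleNumbers.
Variable R : realType.
Implicit Types (f g : nat -> bool) (r s t y : R).

(** Distinct [f] share only finitely many prefixes, hence only finitely many digits 1. *)
Definition liouville_digits f (k : nat) : bool :=
  `[< exists n, k = (prefix_code f n)`! >].

Definition dyadic (k : nat) y := exists z : int, y * 2 ^+ k = z%:~R.

Lemma dyadicB k x y : dyadic k x -> dyadic k y -> dyadic k (x - y).
Proof. by move=> [z xz] [z' yz]; exists (z - z'); rewrite mulrBl xz yz intrB. Qed.

Lemma dyadicD k x y : dyadic k x -> dyadic k y -> dyadic k (x + y).
Proof. by move=> [z xz] [z' yz]; exists (z + z'); rewrite mulrDl xz yz intrD. Qed.

Lemma dyadicM k l x y : dyadic k x -> dyadic l y -> dyadic (k + l) (x * y).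
Proof.
by move=> [z xz] [z' yz]; exists (z * z'); rewrite exprD mulrACA xz yz intrM.
Qed.

Lemma dyadicW k l y : (k <= l)%N -> dyadic k y -> dyadic l y.
Proof.
move=> /subnKC <- [z yz]; exists (z * 2 ^+ (l - k)).
by rewrite exprD mulrA yz intrM rmorphXn.
Qed.

Lemma dyadic_exp2V k : dyadic k (2 ^- k : R).
Proof. by exists 1; rewrite mulVf// expf_neq0. Qed.

Lemma dyadic_digit_sum e k : dyadic k (digit_sum R e k).
Proof.
elim: k => [|k IH]; first by exists 0; rewrite /digit_sum big_geq// mul0r.
rewrite digit_sumS; apply: dyadicD; first exact: dyadicW IH.
by case: (e k); [rewrite mul1r; exact: dyadic_exp2V|exists 0; rewrite !mul0r].
Qed.

(* Between the digits [(K - 1)!] and [(K + 1)!], where [K = prefix_code f n], the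
   number with digits [liouville_digits g] has a gap when [g != f], but not when
   [g = f]. Existence of good dyadic approximations across these gaps is
   preserved by ring operations. *)
Definition gap_approx f r := exists N, forall n, (N <= n)%N -> exists y,
  dyadic (N * (prefix_code f n).-1`!) y /\
  `|r - y| <= 2 ^+ N * 2 ^- (prefix_code f n).+1`!.

Lemma gap_approx1 f : gap_approx f 1.
Proof.
exists 0%N => n _; exists 1; split; first by exists 1; rewrite mul0n expr0 mulr1.
by rewrite subrr normr0 mulr_ge0// ?exprn_ge0// invr_ge0 exprn_ge0.
Qed.

Lemma gap_approx_half f : gap_approx f 2^-1.
Proof.
exists 1%N => n _; exists 2^-1; split.
  by apply: dyadicW (dyadic_exp2V 1); rewrite mul1n fact_gt0.
by rewrite subrr normr0 mulr_ge0// ?exprn_ge0// invr_ge0 exprn_ge0.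
Qed.

Lemma gap_approxB f r s : gap_approx f r -> gap_approx f s -> gap_approx f (r - s).
Proof.
move=> [N rN] [M sM]; exists (N + M).+1 => n NMn.
have [|x [xd rx]] := rN n; first by lia.
have [|y [yd sy]] := sM n; first by lia.
exists (x - y); split.
  by apply: dyadicB; [apply: dyadicW xd|apply: dyadicW yd]; rewrite leq_mul2r; lia.
rewrite (_ : r - s - (x - y) = (r - x) - (s - y)); last by ring.
rewrite (le_trans (ler_normB _ _))// (le_trans (lerD rx sy))// -mulrDl.
rewrite ler_wpM2r ?(ltW (exp2V_gt0 _ _))//.
have -> : 2 ^+ (N + M).+1 = 2 ^+ (N + M) + 2 ^+ (N + M) :> R by rewrite exprS; ring.
by apply: lerD; rewrite ler_weXn2l ?ler1n ?leq_addr ?leq_addl.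
Qed.

(** The exponents of the denominators add up, hence the factor [N] before the factorial in
    [gap_approx]. The error grows only by a constant factor, since [y] is bounded independently of
    [n]. *)
Lemma gap_approxM f r s : gap_approx f r -> gap_approx f s -> gap_approx f (r * s).
Proof.
move=> [N rN] [M sM].
pose c := `|r| * 2 ^+ M + (`|s| + 2 ^+ M) * 2 ^+ N.
exists (N + M + (Num.truncn c).+1)%N => n NMn.
have [|x [xd rx]] := rN n; first by lia.
have [|y [yd sy]] := sM n; first by lia.
exists (x * y); split.
  by apply: dyadicW (dyadicM xd yd); rewrite -mulnDl leq_mul2r leq_addr orbT.
set E := 2 ^- _ in rx sy *.
have E0 : 0 <= E by exact/ltW/exp2V_gt0.
have E1 : E <= 1 by rewrite invf_le1 ?exprn_gt0// exprn_ege1// ler1n.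
have yE : `|y| <= `|s| + 2 ^+ M.
  rewrite -(subrK s y) addrC (le_trans (ler_normD _ _))// lerD2l distrC.
  by rewrite (le_trans sy)// ler_piMr// exprn_ge0.
rewrite (_ : r * s - x * y = r * (s - y) + y * (r - x)); last by ring.
rewrite (le_trans (ler_normD _ _))// !normrM.
apply: (@le_trans _ _ (c * E)).
  rewrite mulrDl -!mulrA lerD// ?ler_wpM2l//.
  by rewrite ler_pM// mulr_ge0 ?exprn_ge0.
rewrite ler_wpM2r//; apply/ltW/(lt_le_trans (truncnS_gt _)).
rewrite -natrX ler_nat (leq_trans (ltnW (ltn_expl _ (isT : (1 < 2)%N))))//.
by rewrite leq_exp2l// leq_addl.
Qed.

Lemma gap_approx_exp2V f k : gap_approx f (2 ^- k).
Proof.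
elim: k => [|k IH]; first by rewrite expr0 invr1; exact: gap_approx1.
by rewrite exprS invfM; apply: gap_approxM => //; exact: gap_approx_half.
Qed.

Lemma digit_sum_gap e k l : (k <= l)%N ->
  (forall j, (k <= j < l)%N -> ~~ e j) -> digit_sum R e l = digit_sum R e k.
Proof.
move=> kl H; rewrite /digit_sum (big_cat_nat (n := k))//=.
rewrite [X in _ + X]big_nat_cond [X in _ + X]big1 ?addr0// => j.
by rewrite andbT => /H /negPf ->; rewrite mul0r.
Qed.

Lemma prefix_code_gt f n : (n < prefix_code f n)%N.
Proof.
have /andP[h _] := prefix_code_bounds f n.
by apply: leq_trans h; exact: ltn_expl.
Qed.

Lemma fact_lt_inv m n : (m`! < n`!)%N -> (m < n)%N.
Proof. by apply: contraLR; rewrite -!leqNgt; exact: leq_fact. Qed.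

Lemma fact_pred n : (0 < n)%N -> n`! = (n * n.-1`!)%N.
Proof. by case: n => // n _; rewrite factS. Qed.

(** Past the first difference, [K] codes no prefix of [g], so the digits of [t] vanish strictly
    between positions [(K - 1)!] and [(K + 1)!], and truncation gives the approximation. *)
Lemma gap_approx_other f g t : f != g -> expands (liouville_digits g) t ->
  gap_approx f t.
Proof.
move=> fg gt; have [i figi] : exists i, f i != g i.
  apply: contrapT => /forallNP H; move: fg; apply/negP/negPn/eqP/funext => i.
  exact/eqP/negPn/negP/H.
exists i.+2 => n ni; set K := prefix_code f n.
exists (digit_sum R (liouville_digits g) K.-1`!.+1).
split.
  apply: dyadicW (dyadic_digit_sum _ _).
  by have := fact_gt0 K.-1; nia.
have KP : (0 < K)%N by exact: leq_ltn_trans (prefix_code_gt f n).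
have mono : (K.-1`!.+1 <= K.+1`!)%N.
  rewrite factS mulSn -addn1 leq_add ?muln_gt0 ?fact_gt0 ?KP//.
  by rewrite leq_fact// leq_pred.
have gap : digit_sum R (liouville_digits g) K.+1`! =
           digit_sum R (liouville_digits g) K.-1`!.+1.
  apply: digit_sum_gap => // j /andP[j1 j2]; apply/negP => /asboolP[m jE].
  move: j1 j2; rewrite jE => /fact_lt_inv K1 /fact_lt_inv K2.
  have /prefix_code_inj[<- H] : prefix_code f n = prefix_code g m.
    by rewrite -/K; lia.
  by move/negP: figi; apply; apply/eqP/H; lia.
have /andP[t1 t2] := gt K.+1`!.
rewrite -gap ger0_norm ?subr_ge0// lerBlDl (le_trans t2)// lerD2l.
by rewrite ler_peMl ?(ltW (exp2V_gt0 _ _))// exprn_ege1// ler1n.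
Qed.

(** An approximation [y] must equal the truncation [y0] of [t] before digit [K!], as they are closer
    than their denominators permit for distinct numbers. But digit [K!] is 1, so [t - y0] exceeds
    the allowed error. *)
Lemma not_gap_approx f t : expands (liouville_digits f) t -> ~ gap_approx f t.
Proof.
(* With [K >= N + 5], the exponent [K! = K * (K - 1)!] exceeds by at least 2 the exponent [D] of a
   common denominator of [y] and [y0]. *)
move=> ft [N HN]; have [|y [yd ty]] := HN (N + 4)%N; first by rewrite leq_addr.
move: yd ty; set K := prefix_code f _ => yd ty.
have KN : (N + 4 < K)%N by exact: prefix_code_gt.
have KP : (0 < K)%N by exact: leq_ltn_trans KN.
set hm := K.-1`! in yd; have hm0 : (0 < hm)%N by exact: fact_gt0.
set hp := K.+1`! in ty; set h := K`!.
have hE : h = (K * hm)%N by exact: fact_pred.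
have hpE : hp = (K.+1 * h)%N by rewrite /hp factS.
pose y0 := digit_sum R (liouville_digits f) hm.+1.
have y0E : digit_sum R (liouville_digits f) h = y0.
  apply: digit_sum_gap; first by rewrite hE; nia.
  move=> j /andP[j1 j2]; apply/negP => /asboolP[m jE].
  by move: j1 j2; rewrite jE => /fact_lt_inv K1 /fact_lt_inv K2; lia.
have hdig : digit_sum R (liouville_digits f) h.+1 = y0 + 2 ^- h.+1.
  rewrite digit_sumS y0E (_ : liouville_digits f h) ?mul1r//.
  by apply/asboolP; exists (N + 4)%N.
have /andP[t1 _] := ft h.+1; rewrite hdig in t1.
have /andP[t0 t2] := ft h; rewrite y0E in t0 t2.
pose D := (N * hm + hm.+1)%N.
have [z zE] : dyadic D (y - y0).
  apply: dyadicB; first by apply: dyadicW yd; rewrite leq_addr.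
  by apply: dyadicW (dyadic_digit_sum _ _); rewrite leq_addl.
have exp_le a b : (a <= b)%N -> 2 ^+ a * 2 ^- b <= 1 :> R.
  by move=> ab; rewrite ler_pdivrMr ?exprn_gt0// mul1r ler_weXn2l// ler1n.
have Dh : (D + 2 <= h)%N by rewrite hE /D; nia.
have hhp : (h + N + 2 <= hp)%N by rewrite hpE; nia.
(* An integer below 1 in absolute value: each of the two error terms contributes at most 1/4. *)
have z0 : z = 0.
  have z1 : `|z%:~R : R| < 1.
    rewrite -zE normrM (ger0_norm (exprn_ge0 _ _))//.
    have yy : `|y - y0| <= 2 ^- h + 2 ^+ N * 2 ^- hp.
      rewrite (_ : y - y0 = (t - y0) - (t - y)); last by ring.
      rewrite (le_trans (ler_normB _ _))// lerD// ger0_norm; lra.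
    apply: le_lt_trans (ler_wpM2r _ yy) _; first by rewrite exprn_ge0.
    have a1 : 2 ^+ (D + 2) * 2 ^- h <= 1 :> R by exact: exp_le.
    have a2 : 2 ^+ (D + 2 + N) * 2 ^- hp <= 1 :> R by apply: exp_le; lia.
    have e4 : 2 ^+ 2 = 4 :> R by rewrite expr2; ring.
    have b1 : 4 * (2 ^- h * 2 ^+ D) <= 1 :> R.
      apply: le_trans a1; rewrite exprD e4 le_eqVlt.
      by apply/orP/or_introl/eqP; ring.
    have b2 : 4 * (2 ^+ N * 2 ^- hp * 2 ^+ D) <= 1 :> R.
      apply: le_trans a2; rewrite !exprD e4 le_eqVlt.
      by apply/orP/or_introl/eqP; ring.
    rewrite mulrDl; lra.
  move: z1; rewrite -intr_norm -[1]/(1%:~R) ltr_int.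
  by case: z {zE} => [[|z]|z].
have yy0 : y = y0.
  move/eqP: zE; rewrite z0 mulf_eq0 expf_eq0 pnatr_eq0 andbF orbF subr_eq0.
  by move/eqP.
have : 2 ^+ h.+1 * (2 ^+ N * 2 ^- hp) < 1 :> R.
  have a2 : 2 ^+ (h + N + 2) * 2 ^- hp <= 1 :> R by exact: exp_le.
  have e4 : 2 ^+ 2 = 4 :> R by rewrite expr2; ring.
  have p0 : 0 < 2 ^+ h * 2 ^+ N * 2 ^- hp :> R.
    by rewrite !mulr_gt0 ?exprn_gt0// exp2V_gt0.
  rewrite exprS; move: a2; rewrite !exprD e4; lra.
apply/negP; rewrite -leNgt mulrC -ler_pdivrMr ?exprn_gt0// mul1r.
apply: le_trans ty; rewrite yy0; apply: le_trans (ler_norm _).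
by rewrite lerBrDl.
Qed.

(** No factorial is 0 and the empty prefix has code 1, so the binary expansion starts 0.01 and [t]
    lies in [1/4, 1/2]. *)
Lemma liouville_lt1 f t : expands (liouville_digits f) t -> 0 < t < 1.
Proof.
move=> ft; have /andP[t1 _] := ft 2%N; have /andP[_ t2] := ft 1%N.
have d0 : liouville_digits f 0 = false.
  by apply/asboolP => -[n]; have := fact_gt0 (prefix_code f n); lia.
have d1 : liouville_digits f 1 by apply/asboolP; exists 0%N.
rewrite !digit_sumS /digit_sum big_geq// d0 d1 /= mul0r mul1r !add0r in t1 t2.
apply/andP; split; first exact: lt_le_trans (exp2V_gt0 _ _) t1.
by apply: le_lt_trans t2 _; rewrite invf_lt1 ?exprn_gt0// expr1 ltr1n.
Qed.

End LiouvilleNumbers.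

(** * Coding families *)

(* The rows [(true, x)] carry the coded densities, the row [(false, B)] is
   reserved for destroying the independence of [B]. *)
Definition row : Type := (bool * set nat)%type.

Definition cantor_point (i : row * nat) (k : nat) : bool :=
  match k with
  | 0 => i.1.1
  | k'.+1 => if odd k' then k'./2 == i.2 else k'./2 \in i.1.2
  end.

Lemma cantor_point_inj : injective cantor_point.
Proof.
move=> [[b x] i] [[b' x'] i'] E.
have -> : b = b' by exact: (congr1 (@^~ 0%N) E).
have -> : i = i'.
  have := congr1 (@^~ (i.*2.+1).+1) E.
  by rewrite /= odd_double /= uphalf_double eqxx => /esym/eqP.
suff -> : x = x' by [].
apply/seteqP; split => j xj; have := congr1 (@^~ (j.*2).+1) E;
  rewrite /= odd_double doubleK => xx'; apply: set_mem; [rewrite -xx'|rewrite xx'];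
  exact: mem_set.
Qed.

(** With [setT], a collapsed coding row has exactly the Liouville-like number as its density. *)
Definition row_base (r : row) : set nat := if r.1 then setT else r.2.

Section Construction.
Variable R : realType.

Lemma row_digits_exist (r : row) : exists ew : (nat -> bool) * R,
  if r.1 then ew.1 = liouville_digits (fun k => k \in r.2) /\ expands ew.1 ew.2
  else (exists k, ew.2 = 2 ^- k.+1) /\
    (0 < density R r.2 < 1 -> exists t, expands ew.1 t /\ ew.2 = density R r.2 * t).
Proof.
case: r => -[] B /=.
  have [t et] := expansion_exists R (liouville_digits (fun k => k \in B)).
  by exists (liouville_digits (fun k => k \in B), t).
have [b01|nb] := pselect (0 < density R B < 1); last first.
  (* A default value that keeps the weight a power of 1/2. *)
  by exists (fun=> false, 2 ^- 1) => /=; split => //; exists 0%N.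
set b := density R B in b01 *; have /andP[b0 b1] := b01.
(* Since [2 ^- k <= b], the ratio [2 ^- k.+1 / b] is at most 1 and can serve as [t]. *)
have [k bk] := exp2V_small 1 b0; rewrite mul1r in bk.
have [|d dt] := @digits_exist _ (2 ^- k.+1 / b).
  rewrite divr_ge0 ?(ltW b0) ?(ltW (exp2V_gt0 _ _))//= ler_pdivrMr// mul1r.
  by apply: le_trans bk; rewrite (exp2VS _ k) lerDl ltW// exp2V_gt0.
exists (d, 2 ^- k.+1) => /=; split; first by exists k.
move=> _; exists (2 ^- k.+1 / b); split=> //.
by rewrite mulrC divfK// gt_eqF.
Qed.

Let ew := projT1 (choice row_digits_exist).
Let ewP := projT2 (choice row_digits_exist).
Let e r := (ew r).1.
Let w r := (ew r).2.

Let w01 r : 0 < w r < 1.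
Proof.
rewrite /w; have := ewP r; rewrite -/ew; case: ifP => _.
  by move=> [E et]; rewrite E in et; exact: liouville_lt1 et.
move=> [[k ->] _]; rewrite exp2V_gt0 invf_lt1 ?exprn_gt0//.
by rewrite exprn_egt1// ltr1n.
Qed.

Let C (i : row * nat) : set nat := bit_set (cantor_point i).

Let C_indep : independent setT C (fun=> 2^-1 : R).
Proof. exact: bit_set_independent cantor_point_inj. Qed.

Let w_ge0 r : 0 <= w r.
Proof. by case/andP: (w01 r) => /ltW. Qed.

Let family S := row_set C row_base e S @` row_dom S.
Let allowed (alpha : set (set nat)) : set row := [set r : row | r.1 -> alpha r.2].

(** * Families given by a maximal set of collapsed rows *)

Section Maximal.
Variables (alpha : set (set nat)) (S : set row).
Hypothesis SW : S `<=` allowed alpha.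
Hypothesis Sind : row_independent C row_base e w S.
Hypothesis Smax : forall r, allowed alpha r -> ~ S r ->
  ~ row_independent C row_base e w (r |` S).

Let weight01 i : row_dom S i -> 0 < row_weight w S i < 1.
Proof.
move=> _; rewrite /row_weight; case: ifP => _; first exact: w01.
by rewrite invr_gt0 ltr0n invf_lt1// ltr1n.
Qed.

Let dom0 r : row_dom S (r, 0%N). Proof. by []. Qed.

(** Collapsing a row whose base is [setT] always preserves independence, so maximality forces it
    into [S]. *)
Let S_code x : alpha x -> S (true, x).
Proof.
move=> ax; apply: contrapT => nS; apply: (Smax (r := (true, x))) => //.
have [ed et] := ewP (true, x).
apply: (row_independentU1 w_ge0 Sind nS et ler01) => [|F FD]; first by rewrite mul1r.
rewrite mul1r; apply: eq_has_mean (Sind FD) => n.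
by rewrite /row_base /= indicT /= mul1r.
Qed.

(** Let [B] be a new member of a larger family. If row [(false, B)] is not in [S], collapsing it
    contradicts the maximality of [S]; if it is, its weight [w] satisfies [w = density R B * w],
    which is impossible. *)
Lemma family_maximal : maximal_d_independent R (family S).
Proof.
have Find : d_independent R (family S).
  by apply: (independent_d_independent Sind weight01); exists ((true, set0), 0%N).
split=> // -[A [Aind [FA nA]]].
have [B [AB nB]] : exists B, A B /\ ~ family S B.
  apply: contrapT => H; apply: nA => B AB; apply: contrapT => nB.
  by apply: H; exists B.
have B01 : 0 < density R B < 1 by have [_ + _ _] := Aind; apply.
have BF := independent_extension Sind weight01 Aind FA AB nB.
have [_ /(_ B01) [t [et wE]]] := ewP (false, B).
have [SB|nSB] := pselect (S (false, B)); last first.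
  apply: (Smax (r := (false, B))) => //.
  apply: (row_independentU1 w_ge0 Sind nSB et _ wE) => //.
  by case/andP: B01 => /ltW.
(* [B] contains the member of the family at index [(false, B)] *)
have wB : row_weight w S ((false, B), 0%N) = w (false, B).
  by rewrite /row_weight /= mem_set.
have F1 : [set` [fset ((false, B), 0%N)]%fset] `<=` row_dom S.
  by move=> i; rewrite /= inE => /eqP ->.
have := BF _ F1; rewrite big_seq_fset1 wB.
have := independent_has_mean Sind (@dom0 (false, B)); rewrite wB => h1 h2.
have : w (false, B) = density R B * w (false, B).
  apply: has_mean_unique h1 _; apply: eq_has_mean h2 => n.
  rewrite big_seq_fset1 /row_set /= mem_set// indicI /= mulrA /row_base /=.
  by rewrite -[in LHS]/((\1_B \* \1_B) n) -indicI setIid.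
have /andP[w0 _] := w01 (false, B); case/andP: B01 => _ b1 E.
by move: b1; rewrite -(ltr_pM2r w0) -E mul1r ltxx.
Qed.

Lemma family_card : (family S #= [set: set nat])%card.
Proof.
apply: Cantor_Bernstein; first exact: subset_card_le.
(* The index [((true, B), 0)] lies in the domain whether or not its row is collapsed. *)
pose g B := row_set C row_base e S ((true, B), 0%N).
have ginj : {in [set: set nat] &, injective g}.
  move=> B B' _ _ /(independent_inj Sind weight01 (@dom0 _) (@dom0 _)).
  by case.
apply: (@card_le_trans _ _ _ (range g)).
  by have := inj_card_eq ginj; rewrite card_eq_le => /andP[].
apply: subset_card_le => _ [B _ <-].
by exists ((true, B), 0%N).
Qed.

Lemma density_code x : alpha x ->
  (density R @` generated_field (family S)) (w (true, x)).
Proof.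
move=> /S_code Sx; exists (row_set C row_base e S ((true, x), 0%N)).
  by apply: sub_gen_smallest; exists ((true, x), 0%N).
have /has_mean_indicP[_ ->] := independent_has_mean Sind (@dom0 (true, x)).
by rewrite /row_weight /= mem_set.
Qed.

(** The subring [gap_approx f] contains all weights: powers of 1/2, and [w (true, y)] for [y] in
    [alpha], hence different from [x]. So it contains all densities of the generated field, but not
    [w (true, x)]. *)
Lemma density_not_code x : ~ alpha x ->
  ~ (density R @` generated_field (family S)) (w (true, x)).
Proof.
move=> nx [Y FY wE]; pose f k := k \in x.
have [ed et] := ewP (true, x); rewrite /= in ed.
apply: (@not_gap_approx R f (w (true, x))); first by rewrite -[liouville_digits f]ed.
have [| | | |m mf /has_mean_indicP[_ mE]] :=
  independent_generated Sind (Q := gap_approx f) _ _ _ _ FY.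
- exact: gap_approx1.
- exact: gap_approxB.
- exact: gap_approxM.
- move=> i _; rewrite /row_weight; case: ifP => [/set_mem Si|_]; last first.
    exact: gap_approx_half.
  have := SW Si; have := ewP i.1; case: (i.1) => -[] y; rewrite -/ew -/(w _) /=.
    move=> [ed' et'] ay; rewrite ed' in et'.
    apply: gap_approx_other et'; apply/eqP => fE; apply: nx.
    suff -> : x = y by exact: ay.
    apply/seteqP; split=> k; have := congr1 (@^~ k) fE; rewrite /f => kE xk;
      apply: set_mem; [rewrite -kE|rewrite kE]; exact: mem_set.
  by move=> [[k ->] _] _; exact: gap_approx_exp2V.
- by rewrite -wE mE.
Qed.

End Maximal.

(** [t] is fixed before [alpha], so that [alpha] can be read off from the set of densities alone. *)
Lemma coding_families : exists t : set nat -> R, forall alpha : set (set nat),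
  exists A, [/\ maximal_d_independent R A, (A #= [set: set nat])%card &
    forall x, (density R @` generated_field A) (t x) <-> alpha x].
Proof.
exists (fun x => w (true, x)) => alpha.
have [S [SW Sind Smax]] :=
  maximal_row_independent row_base e w C_indep (allowed alpha).
exists (family S); split.
- exact: (family_maximal Sind Smax).
- exact: family_card Sind.
- move=> x; split; last exact: density_code Sind Smax _.
  move=> H; apply: contrapT => nx.
  by have := density_not_code SW Sind nx H.
Qed.

End Construction.

(* [set (set nat)] is an index type of cardinality 2^c, and c is the cardinality
   of [set: set nat]. *)
Theorem theorem2p11 (R : realType) :
  exists A : set (set nat) -> set (set nat),
    (forall alpha, maximal_d_independent R (A alpha)) /\
    (forall alpha, (A alpha #= [set: set nat])%card) /\
    (forall alpha beta, alpha <> beta ->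
       density R @` generated_field (A alpha) <>
       density R @` generated_field (A beta)).
Proof.
have [t /choice[A tA]] := coding_families R.
exists A; split=> [alpha|]; first by have [] := tA alpha.
split=> [alpha|alpha beta ab E]; first by have [] := tA alpha.
apply: ab; apply/seteqP; split=> x.
- by have [_ _ tx] := tA alpha; have [_ _ ty] := tA beta; rewrite -tx E ty.
- by have [_ _ tx] := tA alpha; have [_ _ ty] := tA beta; rewrite -ty -E tx.
Qed.
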